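(* Every element $f\in 2V$ has a unique reduced grid tree-pair diagram.
   Context: A basic dyadic interval is an interval $\left[\frac{i-1}{2^k},\frac{i}{2^k}\right]$ with $k\in\{0,1,2,\dots\}$ and $i\in\{1,\dots,2^k\}$. A basic dyadic rectangle is a product of two basic dyadic intervals. (To obtain honest bijections, intervals may be taken half-open $[\cdot,\cdot)$ and the unit square to be $[0,1)^2$.) A dyadic subdivision of the unit square is a partition of it into finitely many basic dyadic rectangles obtained from the whole square by repeatedly halving rectangles, either by a vertical segment (left/right halves) or by a horizontal segment (top/bottom halves). The group $2V$ consists of all bijections $f$ of the unit square for which there exist two dyadic subdivisions with the same number of rectangles (source and target) and a bijection between their rectangles such that $f$ maps each source rectangle onto the corresponding target rectangle by the affine map $(x,y)\mapsto(2^{p}x+c,\,2^{q}y+d)$ ($p,q\in\mathbb{Z}$). Such a pair of subdivisions with the matching is a diagram representing $f$. Below, ''$f$ is affine on a rectangle'' means that $f$ restricts there to a single map of this form. A grid subdivision of the unit square is a product subdivision: it is given by two finite rooted binary trees $T_v$ and $T_h$, where the leaves of $T_v$ are basic dyadic intervals $I_1,\dots,I_m$ forming a subdivision of the bottom edge $[0,1]$ by iterated halving (all carets of $T_v$ are of vertical type), the leaves of $T_h$ are basic dyadic intervals $J_1,\dots,J_n$ forming a subdivision of the left edge $[0,1]$ by iterated halving (all carets of $T_h$ are of horizontal type), and the rectangles are all $I_i\times J_j$. The trees $T_v,T_h$ and the grid subdivision determine each other. A grid tree-pair diagram (grid diagram) of $f$ is a diagram representing $f$ whose source subdivision is a grid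 subdivision; thus $f$ is affine on each $I_i\times J_j$, with image a basic dyadic rectangle, and the target subdivision and matching consist of these images. Two grid diagrams of $f$ are the same if they have the same source grid subdivision, that is, the same pair $(T_v,T_h)$. An exposed caret of a tree is an interior node both of whose children are leaves. A grid diagram of $f$ is vertically reduced if for every exposed caret of $T_v$, with leaves $I_i$ and $I_{i+1}$, there is some $j\in\{1,\dots,n\}$ such that either $f$ is not affine on $(I_i\cup I_{i+1})\times J_j$, or $f$ is affine there but the image of $(I_i\cup I_{i+1})\times J_j$ is not a basic dyadic rectangle. It is horizontally reduced if the analogous condition, with the roles of the two coordinates exchanged, holds for every exposed caret of $T_h$. It is reduced if it is both vertically and horizontally reduced. *)

(* Defs.v *)
From mathcomp Require Import all_boot all_order all_algebra.
From mathcomp Require Import classical_sets functions set_interval reals.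

Set Implicit Arguments.
Unset Strict Implicit.
Unset Printing Implicit Defensive.

Import Order.TTheory GRing.Theory Num.Theory.

Local Open Scope classical_set_scope.
Local Open Scope ring_scope.

(* [(k, i)] encodes the half-open interval [i / 2^k, (i + 1) / 2^k); it is basic
   dyadic when [i < 2 ^ k] (indices start at 0). *)
Definition interval_code : Type := (nat * nat)%type.

Definition rect_code : Type := (interval_code * interval_code)%type.

(* For intervals on the left edge these are the bottom and top halves. *)
Definition lhalf (I : interval_code) : interval_code := (I.1.+1, I.2.*2).
Definition rhalf (I : interval_code) : interval_code := (I.1.+1, I.2.*2.+1).

Definition unit_itv : interval_code := (0%N, 0%N).

Inductive dyadic_subdivision : seq rect_code -> Prop :=
| subdivision_unit : dyadic_subdivision [:: (unit_itv, unit_itv)]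
| subdivision_vertical s1 s2 I J :
    dyadic_subdivision (s1 ++ (I, J) :: s2) ->
    dyadic_subdivision (s1 ++ [:: (lhalf I, J), (rhalf I, J) & s2])
| subdivision_horizontal s1 s2 I J :
    dyadic_subdivision (s1 ++ (I, J) :: s2) ->
    dyadic_subdivision (s1 ++ [:: (I, lhalf J), (I, rhalf J) & s2]).

Inductive tree : Type := Leaf | Caret of tree & tree.

Fixpoint leaves_from (I : interval_code) (T : tree) : seq interval_code :=
  if T is Caret l r then leaves_from (lhalf I) l ++ leaves_from (rhalf I) r
  else [:: I].

Definition leaves (T : tree) : seq interval_code := leaves_from unit_itv T.

(* Each exposed caret is given by its two leaves. *)
Fixpoint exposed_from (I : interval_code) (T : tree) :
    seq (interval_code * interval_code) :=
  match T with
  | Leaf => [::]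
  | Caret Leaf Leaf => [:: (lhalf I, rhalf I)]
  | Caret l r => exposed_from (lhalf I) l ++ exposed_from (rhalf I) r
  end.

Definition exposed_carets (T : tree) : seq (interval_code * interval_code) :=
  exposed_from unit_itv T.

Definition grid (Tv Th : tree) : seq rect_code :=
  allpairs pair (leaves Tv) (leaves Th).

Section TwoV.
Variable R : realType.

Definition itv_set (I : interval_code) : set R :=
  `[I.2%:R / 2 ^+ I.1, I.2.+1%:R / 2 ^+ I.1[.

Definition rect_set (r : rect_code) : set (R * R) :=
  itv_set r.1 `*` itv_set r.2.

Definition unit_square : set (R * R) := `[0, 1[ `*` `[0, 1[.

Definition basic_dyadic_interval (A : set R) : Prop :=
  exists k i : nat, (i < 2 ^ k)%N /\ A = itv_set (k, i).

Definition basic_dyadic_rectangle (A : set (R * R)) : Prop :=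
  exists I J : set R,
    [/\ basic_dyadic_interval I, basic_dyadic_interval J & A = I `*` J].

(* A bijection of the unit square is a function [f] on the plane with
   [set_bij unit_square unit_square f]; the definitions below only look at the
   values of [f] inside the unit square. *)
Implicit Type f : R * R -> R * R.

Definition affine_on f (A : set (R * R)) : Prop :=
  exists (p q : int) (c d : R), forall x y : R,
    A (x, y) -> f (x, y) = (2 ^ p * x + c, 2 ^ q * y + d).

Definition represents f (s t : seq rect_code)
    (m : 'I_(size s) -> 'I_(size t)) : Prop :=
  [/\ dyadic_subdivision s, dyadic_subdivision t, bijective m &
      forall i : 'I_(size s),
        affine_on f (rect_set (tnth (in_tuple s) i)) /\
        f @` rect_set (tnth (in_tuple s) i)
          = rect_set (tnth (in_tuple t) (m i))].

Definition in_2V f : Prop :=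
  set_bij unit_square unit_square f /\
  exists (s t : seq rect_code) (m : 'I_(size s) -> 'I_(size t)),
    represents f m.

(* The target subdivision and the matching are determined by [f] and the
   source, up to the order of the list [t]; hence a grid diagram of [f] is
   identified with its pair of trees. *)
Definition grid_diagram f (Tv Th : tree) : Prop :=
  exists (t : seq rect_code) (m : 'I_(size (grid Tv Th)) -> 'I_(size t)),
    represents f m.

Definition vertically_reduced f (Tv Th : tree) : Prop :=
  forall I I' : interval_code, (I, I') \in exposed_carets Tv ->
  exists2 J : interval_code, J \in leaves Th &
    let A := (itv_set I `|` itv_set I') `*` itv_set J in
    ~ affine_on f A \/ (affine_on f A /\ ~ basic_dyadic_rectangle (f @` A)).

Definition horizontally_reduced f (Tv Th : tree) : Prop :=
  forall J J' : interval_code, (J, J') \in exposed_carets Th ->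
  exists2 I : interval_code, I \in leaves Tv &
    let A := itv_set I `*` (itv_set J `|` itv_set J') in
    ~ affine_on f A \/ (affine_on f A /\ ~ basic_dyadic_rectangle (f @` A)).

Definition reduced_grid_diagram f (Tv Th : tree) : Prop :=
  [/\ grid_diagram f Tv Th, vertically_reduced f Tv Th
    & horizontally_reduced f Tv Th].

End TwoV.

(* Main.v *)
Require Import Defs.
From mathcomp Require Import all_boot all_order all_algebra.
From mathcomp Require Import classical_sets functions set_interval reals.
From mathcomp Require Import boolp zify ring lra.

Set Implicit Arguments.
Unset Strict Implicit.
Unset Printing Implicit Defensive.

Import Order.TTheory GRing.Theory Num.Theory.

Local Open Scope classical_set_scope.
Local Open Scope ring_scope.

(* Call a dyadic rectangle good if f is affine on it with dyadic image. Good
   rectangles are stable under passing to dyadic sub-rectangles, and a grid is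
   the source of a grid diagram iff all its cells are good: in dimension two
   every tiling by dyadic rectangles is a dyadic subdivision, so the images of
   the cells form one. A deep enough full grid has good cells, and removing
   reducible exposed carets from it ends in a reduced diagram. For uniqueness,
   let (Tv, Th) be reduced and (Tv', Th') be any grid diagram. If Tv is not
   contained in Tv', some exposed caret of Tv lies over an interval I inside a
   leaf of Tv'. For J a leaf of Th, the left half of I times J is good and I
   times M is good for every M in J coming from Th'; these fit together, so
   I times J is good for all J, contradicting reducedness. Hence Tv is contained
   in Tv', and two reduced diagrams have the same trees. *)

(** * Nesting of dyadic codes *)

(** Containment read off the binary digits: dropping the last [I.1 - J.1] digits of the index of [I]
    must leave the index of [J]. *)
Definition sub_itv (I J : interval_code) : bool :=
  (J.1 <= I.1)%N && (I.2 %/ 2 ^ (I.1 - J.1) == J.2)%N.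

Lemma sub_itv_refl I : sub_itv I I.
Proof. by rewrite /sub_itv leqnn subnn divn1 eqxx. Qed.

Lemma sub_itv_trans J I K : sub_itv I J -> sub_itv J K -> sub_itv I K.
Proof.
move=> /andP[ji /eqP eJ] /andP[kj /eqP eK]; apply/andP; split.
  exact: leq_trans ji.
by rewrite -eK -eJ -divnMA -expnD addnBA // subnK.
Qed.

Lemma lhalf_sub I : sub_itv (lhalf I) I.
Proof. by rewrite /sub_itv /= leqnSn subSnn -muln2 mulnK // eqxx. Qed.

Lemma rhalf_sub I : sub_itv (rhalf I) I.
Proof.
by rewrite /sub_itv /= leqnSn subSnn; apply/eqP; rewrite -muln2; lia.
Qed.

(** The digit of [A.2] that follows the prefix [I.2] selects the half. *)
Lemma sub_itv_halves A I :
  sub_itv A I -> [\/ A = I, sub_itv A (lhalf I) | sub_itv A (rhalf I)].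
Proof.
case: A I => [k a] [n i] /andP[/= nk /eqP ei].
have [kn|nk'] := eqVneq k n.
  by apply: Or31; move: ei; rewrite kn subnn divn1 => ->.
have nk1 : (n < k)%N by rewrite ltn_neqAle eq_sym nk' nk.
have : (a %/ 2 ^ (k - n.+1) %/ 2 = i)%N.
  by rewrite -divnMA -expnSr -subSn // subSS.
rewrite /sub_itv /= nk1 /=; set q := (a %/ _)%N => qi.
have [->|->] : q = i.*2 \/ q = i.*2.+1 by rewrite -muln2; lia.
  by apply: Or32; rewrite eqxx.
by apply: Or33; rewrite eqxx.
Qed.

Lemma sub_unitE I : sub_itv I unit_itv = (I.2 < 2 ^ I.1)%N.
Proof.
rewrite /sub_itv /= subn0.
have h : (0 < 2 ^ I.1)%N by rewrite expn_gt0.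
apply/eqP/idP => [e|lt]; last exact: divn_small.
by rewrite ltnNge -(divn_gt0 _ h) e.
Qed.

(** * Dyadic intervals on the real line and affine maps between them *)

Section Intervals.
Variable R : realType.
Implicit Types (I J K : interval_code) (x y a c : R).

Definition left_end I : R := I.2%:R / 2 ^+ I.1.
Definition width I : R := (2 ^+ I.1)^-1.

Lemma width_gt0 I : 0 < width I.
Proof. by rewrite invr_gt0 exprn_gt0. Qed.

Lemma itv_setE I x :
  itv_set I x <-> left_end I <= x < left_end I + width I.
Proof.
rewrite /itv_set /left_end /width /= in_itv /=.
by rewrite -[I.2.+1]addn1 natrD mulrDl mul1r.
Qed.

Lemma itv_set_scaled I x :
  itv_set I x <-> I.2%:R <= x * 2 ^+ I.1 < I.2.+1%:R.
Proof.
rewrite /itv_set /= in_itv /= ler_pdivrMr ?exprn_gt0 //.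
by rewrite ltr_pdivlMr ?exprn_gt0.
Qed.

Lemma itv_set_left I : itv_set I (left_end I).
Proof. by apply/itv_setE; have := width_gt0 I; lra. Qed.

Lemma left_end_lhalf I : left_end (lhalf I) = left_end I.
Proof.
rewrite /left_end /= -muln2 natrM exprS; field.
by rewrite expf_neq0 ?pnatr_eq0.
Qed.

Lemma width_lhalf I : width (lhalf I) = width I / 2.
Proof. by rewrite /width /= exprS invfM mulrC. Qed.

Lemma width_rhalf I : width (rhalf I) = width I / 2.
Proof. exact: width_lhalf. Qed.

Lemma left_end_rhalf I : left_end (rhalf I) = left_end I + width I / 2.
Proof.
rewrite /left_end /width /= -addn1 -muln2 natrD natrM exprS; field.
by rewrite expf_neq0 ?pnatr_eq0.
Qed.

Lemma itv_set_halves I x :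
  itv_set I x <-> itv_set (lhalf I) x \/ itv_set (rhalf I) x.
Proof.
have w := width_gt0 I; rewrite !itv_setE left_end_lhalf left_end_rhalf.
rewrite width_lhalf width_rhalf; split=> [|[|]]; last 2 first.
- by lra.
- by lra.
by have [?|?] := ltP x (left_end I + width I / 2); [left|right]; lra.
Qed.

Lemma itv_set_sub I J : sub_itv I J -> @itv_set R I `<=` @itv_set R J.
Proof.
case: I J => [k i] [n j] /andP[/= nk /eqP ej] x /itv_set_scaled /= /andP[l u].
apply/itv_set_scaled => /=.
have p0 : (0 : R) < 2 ^+ (k - n) by rewrite exprn_gt0.
have ek : (2 : R) ^+ k = 2 ^+ n * 2 ^+ (k - n) by rewrite -exprD subnKC.
rewrite -(ler_pM2r p0) -(ltr_pM2r p0) -mulrA -ek -!natrX -!natrM.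
have h := divn_eq i (2 ^ (k - n)).
have h' : (i %% 2 ^ (k - n) < 2 ^ (k - n))%N by rewrite ltn_mod expn_gt0.
rewrite ej in h.
rewrite -natrX in l u; apply/andP; split.
  by apply: le_trans l; rewrite ler_nat; lia.
by apply: lt_le_trans u _; rewrite ler_nat mulSn; lia.
Qed.

(** The ancestor [I'] of [I] at the level of [J] also contains [x], and two intervals of one level
    that share a point have the same index. *)
Lemma itv_set_meet I J x :
  itv_set I x -> itv_set J x -> (J.1 <= I.1)%N -> sub_itv I J.
Proof.
move=> xI xJ ji.
pose I' : interval_code := (J.1, I.2 %/ 2 ^ (I.1 - J.1))%N.
have sI : sub_itv I I' by rewrite /sub_itv /= ji eqxx.
rewrite /sub_itv ji /=; change (I'.2 == J.2).
have := itv_set_sub sI xI; move: xJ => /itv_set_scaled /andP[a b].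
move=> /itv_set_scaled /= /andP[a' b'].
have := le_lt_trans a b'; have := le_lt_trans a' b; rewrite !ltr_nat /=.
by lia.
Qed.

Lemma itv_set_nested I J x : itv_set I x -> itv_set J x ->
  sub_itv I J \/ sub_itv J I.
Proof.
move=> xI xJ; case/orP: (leq_total J.1 I.1) => h; [left|right].
  exact: itv_set_meet xI xJ h.
exact: itv_set_meet xJ xI h.
Qed.

Lemma itv_set_halves_disjoint I x :
  itv_set (lhalf I) x -> itv_set (rhalf I) x -> False.
Proof.
rewrite !itv_setE left_end_lhalf left_end_rhalf width_lhalf width_rhalf.
by move=> /andP[_ h1] /andP[h2 _]; lra.
Qed.

(** For [a > 0] this says that the map taking [x] to [a * x + c] sends [I] onto [K]; the form by
    left end and width passes to halves by pure algebra. *)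
Definition carries a c I K :=
  a * left_end I + c = left_end K /\ a * width I = width K.

Lemma carries_lhalf a c I K : carries a c I K -> carries a c (lhalf I) (lhalf K).
Proof.
by rewrite /carries !left_end_lhalf !width_lhalf => -[-> <-]; rewrite mulrA.
Qed.

Lemma carries_rhalf a c I K : carries a c I K -> carries a c (rhalf I) (rhalf K).
Proof.
rewrite /carries !left_end_rhalf !width_rhalf => -[<- <-].
by rewrite mulrA; split=> //; ring.
Qed.

(** Halves are carried to the corresponding halves, so the descent from [I] to [A] is copied below
    [K]. *)
Lemma carries_sub a c I K A : carries a c I K -> sub_itv A I ->
  exists2 L, sub_itv L K & carries a c A L.
Proof.
have [n] := ubnP (A.1 - I.1)%N; elim: n I K => // n IHn I K le cI AI.
have [->|s|s] := sub_itv_halves AI; first by exists K; rewrite ?sub_itv_refl.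
  have h : (A.1 - (lhalf I).1 < n)%N by case/andP: s le => /=; lia.
  have [L LK cL] := IHn _ _ h (carries_lhalf cI) s.
  by exists L => //; apply: sub_itv_trans LK (lhalf_sub K).
have h : (A.1 - (rhalf I).1 < n)%N by case/andP: s le => /=; lia.
have [L LK cL] := IHn _ _ h (carries_rhalf cI) s.
by exists L => //; apply: sub_itv_trans LK (rhalf_sub K).
Qed.

Lemma carriesP a c I K : 0 < a ->
  carries a c I K <-> forall x, itv_set I x <-> itv_set K (a * x + c).
Proof.
move=> a0; split=> [[eL eW] x|h].
  rewrite !itv_setE -eL -eW -addrA [c + _]addrC addrA -mulrDr.
  by rewrite lerD2r ltrD2r ler_pM2l // ltr_pM2l.
have wI := width_gt0 I; have wK := width_gt0 K.
have aK u : a * ((u - c) / a) + c = u by field; rewrite gt_eqF.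
have eL : a * left_end I + c = left_end K.
  apply/eqP; rewrite eq_le; apply/andP; split; last first.
    by have /itv_setE/andP[] := (h _).1 (itv_set_left I).
  have := itv_set_left K; rewrite -(aK (left_end K)) => /(h _).2.
  by move=> /itv_setE/andP[+ _]; rewrite aK ler_pdivlMr //; lra.
split=> //.
(* If the widths differ, the right end of the shorter interval lies in the longer one, although a
   half-open interval omits its right end. *)
have [lt|lt|//] := ltgtP (a * width I) (width K).
  have /(h _).2/itv_setE : itv_set K (a * (left_end I + width I) + c).
    by apply/itv_setE; nra.
  by lra.
have : itv_set I ((left_end K + width K - c) / a).
  by apply/itv_setE; rewrite ler_pdivlMr // ltr_pdivrMr //; nra.
by move=> /(h _).1; rewrite aK => /itv_setE; lra.
Qed.

(** Two sample points decide: the left end and the midpoint, which is the left end of the right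
    half. *)
Lemma affine_eq_on_itv I a c a' c' :
  (forall x, itv_set I x -> a * x + c = a' * x + c') -> a = a' /\ c = c'.
Proof.
move=> h; have w := width_gt0 I.
have e1 := h _ (itv_set_left I).
have e2 := h _ (itv_set_sub (rhalf_sub I) (itv_set_left (rhalf I))).
rewrite left_end_rhalf in e2.
have : (a - a') * (width I / 2) = 0 by lra.
move=> /eqP; rewrite mulf_eq0 => /orP[/eqP e|/eqP]; last by lra.
have e' : a = a' by lra.
by split=> //; rewrite e' in e1; lra.
Qed.

End Intervals.

(** * Trees and reduction *)

Implicit Types (A I J K : interval_code) (T : tree).

Lemma leaves_from_sub K T A : A \in leaves_from K T -> sub_itv A K.
Proof.
elim: T K => [|l IHl r IHr] K /=.
  by rewrite inE => /eqP->; exact: sub_itv_refl.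
rewrite mem_cat => /orP[/IHl|/IHr] h; apply: sub_itv_trans h _.
  exact: lhalf_sub.
exact: rhalf_sub.
Qed.

Lemma exposed_from_children K l r e :
  e \in exposed_from (lhalf K) l \/ e \in exposed_from (rhalf K) r ->
  e \in exposed_from K (Caret l r).
Proof.
by case: l r => [|? ?] [|? ?] [] //= h; rewrite mem_cat h ?orbT.
Qed.

Lemma exposed_from_parent K T e :
  e \in exposed_from K T -> exists I, e = (lhalf I, rhalf I).
Proof.
elim: T K => [|l IHl r IHr] K //.
have [[-> ->]|->] : (l = Leaf /\ r = Leaf) \/ exposed_from K (Caret l r) =
    exposed_from (lhalf K) l ++ exposed_from (rhalf K) r.
- by case: (l) (r) => [|? ?] [|? ?]; [left|right..].
- by rewrite /= inE => /eqP->; exists K.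
by rewrite mem_cat => /orP[/IHl|/IHr].
Qed.

(** Descending into a child that is not a leaf ends at an exposed caret; the number of leaves drops
    at each step. *)
Lemma exposed_from_caret K l r : exists2 I,
  (lhalf I, rhalf I) \in exposed_from K (Caret l r) & sub_itv I K.
Proof.
have [n] := ubnP (size (leaves_from K (Caret l r))).
elim: n K l r => // n IHn K l r.
have pos A T : (0 < size (leaves_from A T))%N.
  by elim: T A => //= a IHa b _ A; rewrite size_cat addn_gt0 IHa.
case: l => [|l1 l2].
  case: r => [_|r1 r2]; first by exists K; rewrite ?sub_itv_refl //= inE.
  move=> h; have [|I eI sI] := IHn (rhalf K) r1 r2; first by move: h => /=; lia.
  exists I; first by apply: exposed_from_children; right.
  exact: sub_itv_trans sI (rhalf_sub K).
move=> h; have [|I eI sI] := IHn (lhalf K) l1 l2.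
  by have := pos (rhalf K) r; move: h; rewrite /= !size_cat; lia.
exists I; first by apply: exposed_from_children; left.
exact: sub_itv_trans sI (lhalf_sub K).
Qed.

Fixpoint subtree (T T' : tree) : bool :=
  match T, T' with
  | Leaf, _ => true
  | Caret l r, Caret l' r' => subtree l l' && subtree r r'
  | _, _ => false
  end.

Lemma subtree_anti T T' : subtree T T' -> subtree T' T -> T = T'.
Proof.
elim: T T' => [|l IHl r IHr] [|l' r'] //= /andP[? ?] /andP[? ?].
by rewrite (IHl l') // (IHr r').
Qed.

(** If [T] is not contained in [T'], it has a caret at some leaf [A] of [T'], hence an exposed caret
    over an interval inside [A]. *)
Lemma subtreeP K T T' :
  (forall I A, (lhalf I, rhalf I) \in exposed_from K T ->
     A \in leaves_from K T' -> ~ sub_itv I A) -> subtree T T'.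
Proof.
elim: T K T' => [//|l IHl r IHr] K [|l' r'] h.
  have [I eI sI] := exposed_from_caret K l r.
  by case: (h I K eI _ sI); rewrite /= inE.
rewrite /=; apply/andP; split.
  apply: (IHl (lhalf K)) => I A eI lA; apply: h; last by rewrite mem_cat lA.
  by apply: exposed_from_children; left.
apply: (IHr (rhalf K)) => I A eI lA; apply: h; last by rewrite mem_cat lA orbT.
by apply: exposed_from_children; right.
Qed.

Lemma remove_exposed K T I : (lhalf I, rhalf I) \in exposed_from K T ->
  exists T1 s1 s2, leaves_from K T = s1 ++ [:: lhalf I, rhalf I & s2] /\
                   leaves_from K T1 = s1 ++ I :: s2.
Proof.
elim: T K => [|l IHl r IHr] K //.
have [[-> ->]|->] : (l = Leaf /\ r = Leaf) \/ exposed_from K (Caret l r) =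
    exposed_from (lhalf K) l ++ exposed_from (rhalf K) r.
- by case: (l) (r) => [|? ?] [|? ?]; [left|right..].
- rewrite /= inE => /eqP[e1 e2 _]; exists Leaf, [::], [::].
  have -> : K = I by rewrite (surjective_pairing K) (surjective_pairing I) e1;
    congr (_, _); lia.
  by [].
rewrite mem_cat => /orP[/IHl|/IHr] [T1 [s1 [s2 [e1 e2]]]].
  exists (Caret T1 r), s1, (s2 ++ leaves_from (rhalf K) r).
  by rewrite /= e1 e2 -!catA.
exists (Caret l T1), (leaves_from (lhalf K) l ++ s1), s2.
by rewrite /= e1 e2 -!catA.
Qed.

Fixpoint full_tree n :=
  if n is m.+1 then Caret (full_tree m) (full_tree m) else Leaf.

Lemma leaves_from_full n K A :
  A \in leaves_from K (full_tree n) -> A.1 = (K.1 + n)%N.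
Proof.
elim: n K => [|n IHn] K /=; first by rewrite inE addn0 => /eqP->.
by rewrite mem_cat => /orP[/IHn|/IHn] ->; rewrite /= addSnnS.
Qed.

(** * Removal of exposed carets *)

Section Reduction.
Variable G : interval_code -> interval_code -> Prop.

(** [G] stays abstract so that one argument serves both coordinates: it becomes [good f] or, with
    the two trees exchanged, [good_transpose f]. *)
Definition cells (Tv Th : tree) :=
  forall I J, I \in leaves Tv -> J \in leaves Th -> G I J.

Definition vreduced (Tv Th : tree) :=
  forall I, (lhalf I, rhalf I) \in exposed_carets Tv ->
  exists2 J, J \in leaves Th & ~ G I J.

Lemma vreduce Tv Th : cells Tv Th -> ~ vreduced Tv Th ->
  exists2 Tv', cells Tv' Th & (size (leaves Tv') < size (leaves Tv))%N.
Proof.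
move=> cT /existsNP[I] /not_implyP[/remove_exposed[T1 [s1 [s2 [e1 e2]]]] nJ].
exists T1; last by rewrite /leaves e1 e2 !size_cat ltn_add2l /=.
move=> A J; rewrite /leaves e2 mem_cat inE => lA lJ.
have [->|nA] := eqVneq A I.
  by apply: contrapT => nG; apply: nJ; exists J.
apply: cT => //; rewrite /leaves e1 mem_cat !inE.
by move: lA; rewrite (negbTE nA) /= => /orP[]->; rewrite ?orbT.
Qed.

End Reduction.

(** * Comparison of a reduced grid with another grid *)

Section Uniqueness.
Variable R : realType.
Variable G : interval_code -> interval_code -> Prop.
Hypothesis G_sub :
  forall I J A B, G I J -> sub_itv A I -> sub_itv B J -> G A B.
Hypothesis G_glue : forall I J, G (lhalf I) J ->
  (forall y : R, itv_set J y ->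
     exists M, [/\ itv_set M y, sub_itv M J & G I M]) -> G I J.

Lemma leaves_from_cover K T (x : R) : itv_set K x ->
  exists2 A, A \in leaves_from K T & itv_set A x.
Proof.
elim: T K => [|l IHl r IHr] K /= xK; first by exists K; rewrite ?inE.
by case/itv_set_halves: xK => [/IHl|/IHr] [A lA xA]; exists A => //;
  rewrite mem_cat lA ?orbT.
Qed.

(** Reducedness makes [Tv] least among the vertical trees of all grids with good cells; uniqueness
    then follows by antisymmetry. *)
Lemma vreduced_subtree Tv Th Tv' Th' :
  cells G Tv Th -> vreduced G Tv Th -> cells G Tv' Th' -> subtree Tv Tv'.
Proof.
move=> cT vT cT'; apply: (@subtreeP unit_itv) => I A eI lA sIA.
have [J lJ] := vT I eI; apply.
have lI : lhalf I \in leaves Tv.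
  have [T1 [s1 [s2 [e1 _]]]] := remove_exposed eI.
  by rewrite /leaves e1 mem_cat inE eqxx orbT.
apply: G_glue; first exact: cT.
move=> y yJ.
have [J' lJ' yJ'] := leaves_from_cover Th' (itv_set_sub (leaves_from_sub lJ) yJ).
have gJ' := cT' _ _ lA lJ'.
(* The strip at height [y] is the smaller of [J] and [J']; over [I] it lies in the cell of [A] and
   [J']. *)
have [s|s] := itv_set_nested yJ yJ'.
  by exists J; split=> //; [exact: sub_itv_refl|exact: G_sub gJ' sIA s].
by exists J'; split=> //; apply: G_sub gJ' sIA (sub_itv_refl _).
Qed.

End Uniqueness.

(** * Tilings by dyadic rectangles *)

(** The recursive form of a subdivision: cut once, then subdivide the halves independently, whereas
    [dyadic_subdivision] refines one list in place. *)
Inductive subdivides : interval_code -> interval_code -> seq rect_code -> Prop :=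
| subdivides_one I J : subdivides I J [:: (I, J)]
| subdivides_v I J l1 l2 :
    subdivides (lhalf I) J l1 -> subdivides (rhalf I) J l2 ->
    subdivides I J (l1 ++ l2)
| subdivides_h I J l1 l2 :
    subdivides I (lhalf J) l1 -> subdivides I (rhalf J) l2 ->
    subdivides I J (l1 ++ l2).

(** The surrounding lists are arbitrary so that one half can wait in the context while the other is
    refined. *)
Lemma subdivides_dyadic I J l : subdivides I J l -> forall s1 s2,
  dyadic_subdivision (s1 ++ (I, J) :: s2) -> dyadic_subdivision (s1 ++ l ++ s2).
Proof.
elim=> {I J l} [//|I J l1 l2 _ IH1 _ IH2|I J l1 l2 _ IH1 _ IH2] s1 s2 h.
  by rewrite -catA; apply: (IH1); rewrite -cat_rcons; apply: IH2;
     rewrite cat_rcons; apply: subdivision_vertical.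
by rewrite -catA; apply: (IH1); rewrite -cat_rcons; apply: IH2;
   rewrite cat_rcons; apply: subdivision_horizontal.
Qed.

(** The outer induction cuts columns along [Tv], the inner one cuts each column along [Th]. *)
Lemma subdivides_grid I J Tv Th :
  subdivides I J (allpairs pair (leaves_from I Tv) (leaves_from J Th)).
Proof.
elim: Tv I => [|l IHl r IHr] I /=; last first.
  by rewrite allpairs_cat; apply: subdivides_v.
rewrite cats0; elim: Th J => [|l IHl r IHr] J /=; first exact: subdivides_one.
by rewrite map_cat; apply: subdivides_h.
Qed.

Definition swap (X Y : Type) (z : X * Y) := (z.2, z.1).

Lemma swapK (X Y : Type) : cancel (@swap X Y) (@swap Y X).
Proof. by case. Qed.

Lemma subdivides_swap I J l :
  subdivides I J l -> subdivides J I (map (@swap _ _) l).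
Proof.
elim=> {I J l} [I J|I J l1 l2 _ IH1 _ IH2|I J l1 l2 _ IH1 _ IH2] /=.
- exact: subdivides_one.
- by rewrite map_cat; apply: subdivides_h.
- by rewrite map_cat; apply: subdivides_v.
Qed.

Section Tilings.
Variable R : realType.
Implicit Types (r : rect_code) (l : seq rect_code) (z : R * R).

(** A purely geometric notion, without a history of cuts; disjointness says that codes with a common
    point are equal. *)
Record tiling I J l := Tiling {
  tiling_uniq : uniq l;
  tiling_sub r : r \in l -> sub_itv r.1 I && sub_itv r.2 J;
  tiling_disjoint r r' z :
    r \in l -> r' \in l -> rect_set r z -> rect_set r' z -> r = r';
  tiling_cover z : rect_set (I, J) z -> exists2 r, r \in l & rect_set r z }.

Lemma tiling_swap I J l : tiling I J l -> tiling J I (map (@swap _ _) l).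
Proof.
case=> u s d c; split.
- by rewrite map_inj_uniq //; exact: can_inj (@swapK _ _).
- by move=> _ /mapP[r /s h ->]; rewrite andbC.
- move=> _ _ z /mapP[r lr ->] /mapP[r' lr' ->] [h1 h2] [h3 h4].
  by congr swap; apply: (d _ _ (swap z)).
- move=> z [h1 h2]; have [|r lr [h3 h4]] := c (swap z); first by split.
  by exists (swap r); [exact: map_f|split].
Qed.

(** A dyadic interval strictly inside [I] lies in one half, so no tile crosses the vertical midline.
    The right half takes the complementary filter, so that the sizes add up. *)
Lemma tiling_lhalf I J l : tiling I J l -> (forall r, r \in l -> r.1 != I) ->
  tiling (lhalf I) J [seq r <- l | sub_itv r.1 (lhalf I)].
Proof.
case=> u s d c nI; split.
- exact: filter_uniq.
- by move=> r; rewrite mem_filter => /andP[-> /s/andP[]].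
- by move=> r r' z; rewrite !mem_filter => /andP[_ lr] /andP[_ lr']; exact: d.
move=> z [z1 z2].
have [|r lr [zr1 zr2]] := c z.
  by split=> //; apply: itv_set_sub z1; exact: lhalf_sub.
exists r; last by split.
rewrite mem_filter lr andbT; case/andP: (s _ lr) => /sub_itv_halves[e|//|h] _.
  by have := nI _ lr; rewrite e eqxx.
by have := itv_set_halves_disjoint z1 (itv_set_sub h zr1).
Qed.

Lemma tiling_rhalf I J l : tiling I J l -> (forall r, r \in l -> r.1 != I) ->
  tiling (rhalf I) J [seq r <- l | ~~ sub_itv r.1 (lhalf I)].
Proof.
case=> u s d c nI; split.
- exact: filter_uniq.
- move=> r; rewrite mem_filter => /andP[n lr]; have /andP[h ->] := s _ lr.
  case: (sub_itv_halves h) => [e|e|->//]; last by rewrite e in n.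
  by have := nI _ lr; rewrite e eqxx.
- by move=> r r' z; rewrite !mem_filter => /andP[_ lr] /andP[_ lr']; exact: d.
move=> z [z1 z2].
have [|r lr [zr1 zr2]] := c z.
  by split=> //; apply: itv_set_sub z1; exact: rhalf_sub.
exists r; last by split.
rewrite mem_filter lr andbT; apply/negP => h.
exact: itv_set_halves_disjoint (itv_set_sub h zr1) z1.
Qed.

Lemma tiling_size I J l : tiling I J l -> (0 < size l)%N.
Proof.
move=> /tiling_cover /(_ (left_end R I, left_end R J)) [].
  by split; exact: itv_set_left.
by case: l.
Qed.

(* In dimension two a rectangle of full width and a rectangle of full height
   meet, so one of the two midlines of a non-trivial tiling is not crossed. *)
Lemma tiling_subdivides I J l : tiling I J l ->
  exists2 l', perm_eq l' l & subdivides I J l'.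
Proof.
have [n] := ubnP (size l); elim: n I J l => // n IHn I J l le tl.
(* The sides are general because this vertical cut is also applied to the transposed tiling, where
   it amounts to a horizontal cut. Both parts are non-empty, hence both are smaller. *)
have step A B k : (size k < n.+1)%N -> tiling A B k ->
    (forall r, r \in k -> r.1 != A) ->
    exists2 l', perm_eq l' k & subdivides A B l'.
  move=> lek tk nA.
  have tkl := tiling_lhalf tk nA; have tkr := tiling_rhalf tk nA.
  have := tiling_size tkl; have := tiling_size tkr.
  have : (size [seq r <- k | sub_itv r.1 (lhalf A)] +
          size [seq r <- k | ~~ sub_itv r.1 (lhalf A)] = size k)%N.
    by rewrite !size_filter; exact: count_predC.
  move=> sz sr sl; rewrite -sz ltnS in lek.
  have [|l1 p1 d1] := IHn _ _ _ _ tkl.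
    by apply: leq_trans lek; rewrite -addn1 leq_add2l.
  have [|l2 p2 d2] := IHn _ _ _ _ tkr.
    by apply: leq_trans lek; rewrite -add1n leq_add2r.
  exists (l1 ++ l2); last exact: subdivides_v.
  by apply: perm_trans (perm_cat p1 p2) _; exact/permPl/perm_filterC.
have [/hasP[a la /eqP ea]|/hasPn nI] := boolP (has (fun r => r.1 == I) l);
  last exact: step.
have [/hasP[b lb /eqP eb]|/hasPn nJ] := boolP (has (fun r => r.2 == J) l).
  have [/andP[_ a2] /andP[b1 _]] := (tiling_sub tl la, tiling_sub tl lb).
  (* [a] has full width and [b] full height, so they share the point below. Hence [a] is the whole
     rectangle and every tile meets it. *)
  have eab : a = b.
    apply: (tiling_disjoint tl la lb (z := (left_end R b.1, left_end R a.2))).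
      split=> /=; last exact: itv_set_left.
      by rewrite ea; apply: (itv_set_sub b1); exact: itv_set_left.
    split=> /=; first exact: itv_set_left.
    by rewrite eb; apply: (itv_set_sub a2); exact: itv_set_left.
  have {eb lb b1} ea' : a = (I, J) by rewrite (surjective_pairing a) ea eab eb.
  exists [:: (I, J)]; last exact: subdivides_one.
  apply: uniq_perm => //; first exact: tiling_uniq tl.
  move=> r; rewrite inE; apply/eqP/idP => [->|lr]; first by rewrite -ea'.
  rewrite -ea'.
  apply: (tiling_disjoint tl lr la (z := (left_end R r.1, left_end R r.2))).
    by split; exact: itv_set_left.
  have /andP[r1 r2] := tiling_sub tl lr.
  by rewrite ea'; split; [apply: (itv_set_sub r1)|apply: (itv_set_sub r2)];
     exact: itv_set_left.
have [|||l' pl' dl'] := step J I (map (@swap _ _) l).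
- by rewrite size_map.
- exact: tiling_swap.
- by move=> _ /mapP[r lr ->]; exact: nJ.
exists (map (@swap _ _) l'); last exact: subdivides_swap.
by have := perm_map (@swap _ _) pl'; rewrite mapK //; exact: swapK.
Qed.

Lemma dyadic_subdivision_sub s r : dyadic_subdivision s -> r \in s ->
  sub_itv r.1 unit_itv && sub_itv r.2 unit_itv.
Proof.
move=> ds; elim: ds r => {s} [|s1 s2 I J _ IH|s1 s2 I J _ IH] r.
- by rewrite inE => /eqP->.
- rewrite mem_cat !inE => h.
  have /andP[/= hI hJ] : sub_itv I unit_itv && sub_itv J unit_itv.
    by apply: (IH (I, J)); rewrite mem_cat inE eqxx orbT.
  case/or4P: h => [h|/eqP->|/eqP->|h].
  + by apply: IH; rewrite mem_cat h.
  + by rewrite /= hJ (sub_itv_trans (lhalf_sub I)).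
  + by rewrite /= hJ (sub_itv_trans (rhalf_sub I)).
  + by apply: IH; rewrite mem_cat inE h !orbT.
- rewrite mem_cat !inE => h.
  have /andP[/= hI hJ] : sub_itv I unit_itv && sub_itv J unit_itv.
    by apply: (IH (I, J)); rewrite mem_cat inE eqxx orbT.
  case/or4P: h => [h|/eqP->|/eqP->|h].
  + by apply: IH; rewrite mem_cat h.
  + by rewrite /= hI (sub_itv_trans (lhalf_sub J)).
  + by rewrite /= hI (sub_itv_trans (rhalf_sub J)).
  + by apply: IH; rewrite mem_cat inE h !orbT.
Qed.

Lemma dyadic_subdivision_cover s z : dyadic_subdivision s ->
  rect_set (unit_itv, unit_itv) z -> exists2 r, r \in s & rect_set r z.
Proof.
move=> ds uz; elim: ds => {s} [|s1 s2 I J _ IH|s1 s2 I J _ IH].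
- by exists (unit_itv, unit_itv); rewrite ?inE.
- have [r] := IH; rewrite mem_cat inE => /or3P[h|/eqP->|h] rz.
  + by exists r; rewrite // mem_cat h.
  + case: rz => /= /itv_set_halves[zI|zI] zJ.
      by exists (lhalf I, J); rewrite // mem_cat !inE eqxx ?orbT.
    by exists (rhalf I, J); rewrite // mem_cat !inE eqxx ?orbT.
  + by exists r; rewrite // mem_cat !inE h ?orbT.
- have [r] := IH; rewrite mem_cat inE => /or3P[h|/eqP->|h] rz.
  + by exists r; rewrite // mem_cat h.
  + case: rz => /= zI /itv_set_halves[zJ|zJ].
      by exists (I, lhalf J); rewrite // mem_cat !inE eqxx ?orbT.
    by exists (I, rhalf J); rewrite // mem_cat !inE eqxx ?orbT.
  + by exists r; rewrite // mem_cat !inE h ?orbT.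
Qed.

Lemma tiling_halves I J l1 l2 :
  tiling (lhalf I) J l1 -> tiling (rhalf I) J l2 -> tiling I J (l1 ++ l2).
Proof.
move=> [u1 s1 d1 c1] [u2 s2 d2 c2].
have dis r r' z :
    r \in l1 -> r' \in l2 -> rect_set r z -> rect_set r' z -> False.
  move=> /s1/andP[s _] /s2/andP[s' _] [h _] [h' _].
  exact: itv_set_halves_disjoint (itv_set_sub s h) (itv_set_sub s' h').
split.
- rewrite cat_uniq u1 u2 andbT; apply/hasPn => r r2; apply/negP => r1.
  by apply: (dis r r (left_end R r.1, left_end R r.2)) => //; split;
    exact: itv_set_left.
- move=> r; rewrite mem_cat => /orP[/s1|/s2] /andP[h ->]; rewrite andbT.
    exact: sub_itv_trans h (lhalf_sub I).
  exact: sub_itv_trans h (rhalf_sub I).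
- move=> r r' z; rewrite !mem_cat => /orP[h|h] /orP[h'|h'] rz rz'.
  + exact: d1 rz rz'.
  + by case: (dis _ _ _ h h' rz rz').
  + by case: (dis _ _ _ h' h rz' rz).
  + exact: d2 rz rz'.
- move=> z [/= /itv_set_halves[z1|z1] z2].
    by have [|r lr rz] := c1 z; [split|exists r; rewrite // mem_cat lr].
  by have [|r lr rz] := c2 z; [split|exists r; rewrite // mem_cat lr orbT].
Qed.

Lemma subdivides_tiling I J l : subdivides I J l -> tiling I J l.
Proof.
elim=> {I J l} [I J|I J l1 l2 _ t1 _ t2|I J l1 l2 _ t1 _ t2].
- split=> // [r|r r' z|z zIJ]; rewrite ?inE.
  + by move=> /eqP->; rewrite !sub_itv_refl.
  + by move=> /eqP-> /eqP->.
  + by exists (I, J); rewrite ?inE.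
- exact: tiling_halves.
- have := tiling_swap (tiling_halves (tiling_swap t1) (tiling_swap t2)).
  by rewrite map_cat !mapK //; exact: swapK.
Qed.

Lemma grid_tiling Tv Th : tiling unit_itv unit_itv (grid Tv Th).
Proof. exact/subdivides_tiling/subdivides_grid. Qed.

End Tilings.

(** * Rectangles on which f is affine with dyadic image *)

Section Good.
Variable R : realType.
Implicit Type f : R * R -> R * R.

(** [K] and [L] are the sides of the image. Using [carries] instead of an image of sets lets
    goodness pass to sub-rectangles algebraically. *)
Definition good f I J := exists (p q : int) (c d : R) K L,
  [/\ sub_itv K unit_itv, sub_itv L unit_itv,
      carries (2 ^ p) c I K, carries (2 ^ q) d J L &
      forall x y, itv_set I x -> itv_set J y ->
        f (x, y) = (2 ^ p * x + c, 2 ^ q * y + d)].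

Let pow2_gt0 (p : int) : (0 : R) < 2 ^ p.
Proof. exact: exprz_gt0. Qed.

Lemma good_affine f I J : good f I J -> affine_on f (rect_set (I, J)).
Proof.
by move=> [p [q [c [d [K [L [_ _ _ _ ef]]]]]]];
exists p, q, c, d => x y []; exact: ef.
Qed.

Lemma good_image f I J : good f I J -> exists r : rect_code,
  [/\ sub_itv r.1 unit_itv, sub_itv r.2 unit_itv &
      f @` rect_set (I, J) = rect_set r].
Proof.
move=> [p [q [c [d [K [L [bK bL cK cL ef]]]]]]]; exists (K, L); split=> //.
move: cK cL => /(carriesP _ _ _ (pow2_gt0 p)) hK.
move=> /(carriesP _ _ _ (pow2_gt0 q)) hL.
apply/seteqP; split=> [_ [[x y] [/= xI yJ] <-]|[u v] [/= uK vL]].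
  by rewrite ef //; split; [exact/hK|exact/hL].
have inv (a e w : R) : 0 < a -> a * ((w - e) / a) + e = w.
  by move=> a0; field; rewrite gt_eqF.
have xI : itv_set I ((u - c) / 2 ^ p) by apply/hK; rewrite inv.
have yJ : itv_set J ((v - d) / 2 ^ q) by apply/hL; rewrite inv.
by exists ((u - c) / 2 ^ p, (v - d) / 2 ^ q) => //; rewrite ef // !inv.
Qed.

(** Fixing one coordinate at a left end separates the equality of products into one statement per
    factor, to which [carriesP] applies. *)
Lemma affine_good f I J (r : rect_code) :
  affine_on f (rect_set (I, J)) ->
  sub_itv r.1 unit_itv -> sub_itv r.2 unit_itv ->
  f @` rect_set (I, J) = rect_set r -> good f I J.
Proof.
move=> [p [q [c [d ef]]]]; case: r => K L /= bK bL eKL.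
have ef' x y : itv_set I x -> itv_set J y ->
    f (x, y) = (2 ^ p * x + c, 2 ^ q * y + d) by move=> ? ?; apply: ef.
have img x y : itv_set I x -> itv_set J y ->
    itv_set K (2 ^ p * x + c) /\ itv_set L (2 ^ q * y + d).
  move=> xI yJ; suff : rect_set (K, L) (f (x, y)) by rewrite ef'.
  by rewrite -eKL; exists (x, y).
have pre u v : itv_set K u -> itv_set L v ->
    exists x y,
      [/\ itv_set I x, itv_set J y, u = 2 ^ p * x + c & v = 2 ^ q * y + d].
  move=> uK vL; have : rect_set (K, L) (u, v) by split.
  by rewrite -eKL => -[[x y] [/= xI yJ]]; rewrite ef' // => -[<- <-]; exists x, y.
have inj (a e x y : R) : 0 < a -> a * x + e = a * y + e -> x = y.
  by move=> a0 /addIr; apply: mulfI; rewrite gt_eqF.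
exists p, q, c, d, K, L; split=> //; apply/carriesP => // x; split=> h.
- by have [] := img _ _ h (itv_set_left R J).
- by have [x' [y [xI _ /(inj _ _ _ _ (pow2_gt0 p))-> _]]] :=
    pre _ _ h (itv_set_left R L).
- by have [] := img _ _ (itv_set_left R I) h.
- by have [x' [y [_ yJ _ /(inj _ _ _ _ (pow2_gt0 q))->]]] :=
    pre _ _ (itv_set_left R K) h.
Qed.

Lemma goodP f I J : good f I J <->
  affine_on f (rect_set (I, J)) /\ basic_dyadic_rectangle (f @` rect_set (I, J)).
Proof.
split=> [g|[af [_ [_ [[k [i [ik ->]]] [n [j [jn ->]]] e]]]]].
  split; first exact: good_affine.
  have [[[k i] [n j]] [/= ]] := good_image g; rewrite !sub_unitE /= => ik jn ->.
  by exists (itv_set (k, i)), (itv_set (n, j)); split=> //;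
    [exists k, i|exists n, j].
by apply: (affine_good (r := ((k, i), (n, j))) af) => //=; rewrite sub_unitE.
Qed.

Lemma good_sub f I J A B :
  good f I J -> sub_itv A I -> sub_itv B J -> good f A B.
Proof.
move=> [p [q [c [d [K [L [bK bL cK cL ef]]]]]]] AI BJ.
have [K' KK' cK'] := carries_sub cK AI; have [L' LL' cL'] := carries_sub cL BJ.
exists p, q, c, d, K', L'; split=> //.
- exact: sub_itv_trans KK' bK.
- exact: sub_itv_trans LL' bL.
- by move=> x y xA yB; apply: ef; [exact: itv_set_sub xA|exact: itv_set_sub yB].
Qed.

(* On each strip [I * M] the affine formula is forced by its values on the left
   half, so all strips share the formula valid on [lhalf I * J]. *)
Lemma good_glue f I J : good f (lhalf I) J ->
  (forall y : R, itv_set J y ->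
     exists M, [/\ itv_set M y, sub_itv M J & good f I M]) ->
  good f I J.
Proof.
move=> [p [q [c [d [K0 [L [_ bL _ cL ef]]]]]]] gM.
have agree (M : interval_code) : sub_itv M J -> good f I M ->
    [/\ exists2 K, sub_itv K unit_itv & carries (2 ^ p) c I K &
     forall x y, itv_set I x -> itv_set M y ->
       f (x, y) = (2 ^ p * x + c, 2 ^ q * y + d)].
  move=> MJ [p' [q' [c' [d' [K [L' [bK _ cK _ ef']]]]]]].
  have eqf x y : itv_set (lhalf I) x -> itv_set M y ->
      (2 ^ p * x + c, 2 ^ q * y + d) = (2 ^ p' * x + c', 2 ^ q' * y + d').
    move=> xI yM; rewrite -ef //; last exact: itv_set_sub yM.
    by rewrite ef' //; apply: itv_set_sub xI; exact: lhalf_sub.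
  have [x|ep ec] := @affine_eq_on_itv R (lhalf I) (2 ^ p) c (2 ^ p') c'.
    by move=> /eqf /(_ (itv_set_left R M)) [].
  have [y|eq ed] := @affine_eq_on_itv R M (2 ^ q) d (2 ^ q') d'.
    by move=> /(eqf _ _ (itv_set_left R (lhalf I))) [].
  by rewrite ep ec eq ed; split=> //; exists K.
(* The image [K] of the full width comes from a single strip; the image [L] of the full height comes
   from the left half. *)
have [M0 [_ sM0 gM0]] := gM _ (itv_set_left R J).
have [[K bK cK] _] := agree _ sM0 gM0.
exists p, q, c, d, K, L; split=> // x y xI /gM[M [yM sM /(agree _ sM)[_]]].
exact.
Qed.

(** * Exchange of the coordinates and the two reducedness conditions *)

Definition conj_swap f : R * R -> R * R := fun z => swap (f (swap z)).

Lemma conj_swapK f : conj_swap (conj_swap f) = f.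
Proof. by apply: funext => -[x y]; rewrite /conj_swap /swap /=; case: (f _). Qed.

Lemma good_conj_swap f I J : good f I J -> good (conj_swap f) J I.
Proof.
move=> [p [q [c [d [K [L [bK bL cK cL ef]]]]]]].
exists q, p, d, c, L, K; split=> // x y xJ yI.
by rewrite /conj_swap /swap /= ef.
Qed.

Definition good_transpose f J I := good f I J.

(** Makes transposed goodness an instance of goodness for the conjugated map, so that [good_sub] and
    [good_glue] transfer. *)
Lemma good_transposeE f : good_transpose f = good (conj_swap f).
Proof.
apply: funext => J; apply: funext => I; apply: propext; split.
  exact: good_conj_swap.
by move=> /good_conj_swap; rewrite conj_swapK.
Qed.

(** The two alternatives in the definition of reducedness amount together to the negation of [goodP]
    on the reunited rectangle. *)
Lemma vertically_reducedE f Tv Th :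
  vertically_reduced f Tv Th <-> vreduced (good f) Tv Th.
Proof.
have eA I J : (itv_set (lhalf I) `|` itv_set (rhalf I)) `*` itv_set J
    = rect_set (I, J) :> set (R * R).
  apply/seteqP; split=> -[x y] [/= h ?]; split=> //=; exact/itv_set_halves.
split=> h.
  move=> I /h[J lJ]; rewrite eA => na; exists J => // /goodP[a b].
  by case: na => [|[]].
move=> I I' eI; have [A [eA1 eA2]] := exposed_from_parent eI; subst I I'.
have [J lJ nG] := h A eI; exists J => //; rewrite eA.
have [a|] := pselect (affine_on f (rect_set (A, J))); last by left.
by right; split=> // b; apply: nG; exact/goodP.
Qed.

Lemma horizontally_reducedE f Tv Th :
  horizontally_reduced f Tv Th <-> vreduced (good_transpose f) Th Tv.
Proof.
have eA I J : itv_set I `*` (itv_set (lhalf J) `|` itv_set (rhalf J))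
    = rect_set (I, J) :> set (R * R).
  apply/seteqP; split=> -[x y] [/= ? h]; split=> //=; exact/itv_set_halves.
split=> h.
  move=> J /h[I lI]; rewrite eA => na; exists I => // /goodP[a b].
  by case: na => [|[]].
move=> J J' eJ; have [A [eA1 eA2]] := exposed_from_parent eJ; subst J J'.
have [I lI nG] := h A eJ; exists I => //; rewrite eA.
have [a|] := pselect (affine_on f (rect_set (I, A))); last by left.
by right; split=> // b; apply: nG; exact/goodP.
Qed.

(** * Grid diagrams and grids with good cells *)

Lemma unit_squareE : @unit_square R = rect_set (unit_itv, unit_itv).
Proof.
by rewrite /unit_square /rect_set /itv_set /= expr0 !divr1.
Qed.

Lemma rect_set_unit (r : rect_code) :
  sub_itv r.1 unit_itv -> sub_itv r.2 unit_itv ->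
  rect_set r `<=` @unit_square R.
Proof.
move=> h1 h2 z [z1 z2]; rewrite unit_squareE.
by split; [exact: itv_set_sub z1|exact: itv_set_sub z2].
Qed.

Lemma represents_good f s t (m : 'I_(size s) -> 'I_(size t)) r :
  represents f m -> r \in s -> good f r.1 r.2.
Proof.
case: r => I J [_ dt _ h] rs.
have hi : (index (I, J) s < size s)%N by rewrite index_mem.
have [] := h (Ordinal hi); rewrite !(tnth_nth (I, J)) /= nth_index //.
set j := m _ => af im.
have /andP[b1 b2] := dyadic_subdivision_sub dt (mem_nth (I, J) (ltn_ord j)).
exact: affine_good af b1 b2 im.
Qed.

(** Since [f] is a bijection, the images of the cells tile the square, and [tiling_subdivides] makes
    this tiling a subdivision. *)
Lemma good_grid_diagram f Tv Th : set_bij (@unit_square R) (@unit_square R) f ->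
  cells (good f) Tv Th -> grid_diagram f Tv Th.
Proof.
move=> [_ f_inj f_surj] cT; set s := grid Tv Th.
have /choice[g hg] (r : rect_code) : exists r' : rect_code, r \in s ->
    [/\ sub_itv r'.1 unit_itv, sub_itv r'.2 unit_itv &
        f @` rect_set r = rect_set r'].
  have [|] := boolP (r \in s); last by exists r.
  case/allpairsP=> -[I J] [/= lI lJ ->].
  by have [r' hr'] := good_image (cT _ _ lI lJ); exists r'.
have ds : dyadic_subdivision s.
  rewrite -[s]cats0.
  apply: (subdivides_dyadic (s1 := [::]) (subdivides_grid _ _ _ _)).
  exact: subdivision_unit.
have us (r : rect_code) : r \in s -> rect_set r `<=` @unit_square R.
  by move=> /(dyadic_subdivision_sub ds)/andP[]; exact: rect_set_unit.
have ne (r : rect_code) : rect_set r (left_end R r.1, left_end R r.2).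
  by split; exact: itv_set_left.
(* A common point of two images pulls back to a common point of the cells, by injectivity of [f]. *)
have meet (r r' : rect_code) (z : R * R) : r \in s -> r' \in s ->
    rect_set (g r) z -> rect_set (g r') z ->
    exists2 w : R * R, rect_set r w & rect_set r' w.
  move=> sr sr' gz gz'; have [[_ _ e] [_ _ e']] := (hg r sr, hg r' sr').
  have [w rw ew] : (f @` rect_set r) z by rewrite e.
  have [w' rw' ew'] : (f @` rect_set r') z by rewrite e'.
  exists w => //; rewrite (f_inj w w') ?ew ?ew' // inE; first exact: us rw.
  exact: us rw'.
have inj : {in s &, injective g}.
  move=> r r' sr sr' e.
  have h' : rect_set (g r') (left_end R (g r).1, left_end R (g r).2).
    by rewrite -e; exact: ne.
  have [w rw rw'] := meet _ _ _ sr sr' (ne (g r)) h'.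
  exact: (tiling_disjoint (grid_tiling R Tv Th) sr sr' rw rw').
have tl : tiling R unit_itv unit_itv (map g s).
  split.
  - by rewrite map_inj_in_uniq //; exact: (tiling_uniq (grid_tiling R Tv Th)).
  - by move=> _ /mapP[r /hg[h1 h2 _] ->]; apply/andP.
  - move=> _ _ z /mapP[r sr ->] /mapP[r' sr' ->] h h'.
    have [w rw rw'] := meet _ _ _ sr sr' h h'.
    by rewrite (tiling_disjoint (grid_tiling R Tv Th) sr sr' rw rw').
  - move=> z; rewrite -unit_squareE => /f_surj[w]; rewrite unit_squareE => uw <-.
    have [r sr rw] := dyadic_subdivision_cover ds uw.
    exists (g r); first exact: map_f.
    by have [_ _ e] := hg r sr; rewrite -e; exists w.
have [t pt dt] := tiling_subdivides tl.
(* [t] lists the images in another order, so a cell is matched with the position of its image in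
   [t]. *)
have mt (i : 'I_(size s)) : (index (g (tnth (in_tuple s) i)) t < size t)%N.
  by rewrite index_mem (perm_mem pt) map_f // mem_tnth.
exists t, (fun i => Ordinal (mt i)); split=> //.
- rewrite -[t]cats0; apply: (subdivides_dyadic (s1 := [::]) dt).
  exact: subdivision_unit.
- apply: inj_card_bij; last by rewrite !card_ord (perm_size pt) size_map.
  move=> i j [/(congr1 (nth (unit_itv, unit_itv) t))].
  rewrite !nth_index ?(perm_mem pt) ?map_f ?mem_tnth // => /inj e.
  apply: (tuple_uniqP (in_tuple s)).
    exact: (tiling_uniq (grid_tiling R Tv Th)).
  by apply: e; exact: mem_tnth.
- move=> i; have si : tnth (in_tuple s) i \in s by exact: mem_tnth.
  split.
    have /allpairsP[[I J] [/= lI lJ e]] := si.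
    by rewrite e; apply: good_affine; exact: cT.
  have [_ _ ->] := hg _ si.
  rewrite [X in _ = rect_set X](tnth_nth (unit_itv, unit_itv)) /=.
  by rewrite nth_index // (perm_mem pt) map_f.
Qed.

(** * Existence and comparison of reduced grids *)

Lemma exists_good_cells f : in_2V f -> exists Tv Th, cells (good f) Tv Th.
Proof.
move=> [_ [s [t [m rep]]]]; have [ds _ _ _] := rep.
(* At depth [N] each cell is at least as fine as every source rectangle, so it lies in the one
   containing its lower left corner. *)
pose N := \max_(r <- s) maxn r.1.1 r.2.1.
have leN r : r \in s -> (r.1.1 <= N)%N && (r.2.1 <= N)%N.
  by move=> rs; rewrite -geq_max;
    apply: (leq_bigmax_seq (F := fun r => maxn r.1.1 r.2.1)).
exists (full_tree N), (full_tree N) => I J lI lJ.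
have [|r sr [/= zI zJ]] :=
  @dyadic_subdivision_cover R s (left_end R I, left_end R J) ds.
  split; apply: itv_set_sub (itv_set_left _ _).
    exact: leaves_from_sub lI.
  exact: leaves_from_sub lJ.
have /andP[r1 r2] := leN _ sr.
apply: (good_sub (represents_good rep sr)).
  by apply: itv_set_meet (itv_set_left R I) zI _; rewrite (leaves_from_full lI).
by apply: itv_set_meet (itv_set_left R J) zJ _; rewrite (leaves_from_full lJ).
Qed.

Lemma grid_diagram_cells f Tv Th : grid_diagram f Tv Th -> cells (good f) Tv Th.
Proof.
move=> [t [m rep]] I J lI lJ.
by apply: (represents_good (r := (I, J)) rep); exact: allpairs_f.
Qed.

(** A removal in one tree may spoil reducedness in the other direction, so both tests restart after
    each removal; the total number of leaves decreases. *)
Lemma exists_reduced_cells f Tv Th : cells (good f) Tv Th ->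
  exists Tv' Th', [/\ cells (good f) Tv' Th', vreduced (good f) Tv' Th' &
                      vreduced (good_transpose f) Th' Tv'].
Proof.
have [n] := ubnP (size (leaves Tv) + size (leaves Th)).
elim: n Tv Th => // n IHn Tv Th le cT.
have [vr|/(vreduce cT)[Tv' cT' lt]] :=
  pselect (vreduced (good f) Tv Th); last first.
  by apply: IHn cT'; lia.
have cT' : cells (good_transpose f) Th Tv by move=> J I lJ lI; exact: cT.
have [hr|/(vreduce cT')[Th' cT'' lt]] :=
  pselect (vreduced (good_transpose f) Th Tv).
  by exists Tv, Th.
by apply: (IHn Tv Th'); [lia|move=> I J lI lJ; exact: cT''].
Qed.

Lemma reduced_subtrees f Tv Th Tv' Th' :
  reduced_grid_diagram f Tv Th -> reduced_grid_diagram f Tv' Th' ->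
  subtree Tv Tv' /\ subtree Th Th'.
Proof.
move=> [/grid_diagram_cells c /vertically_reducedE v /horizontally_reducedE h].
move=> [/grid_diagram_cells c' _ _]; split.
  exact: (vreduced_subtree (@good_sub f) (@good_glue f) c v c').
have swap_sub I J A B : good_transpose f I J -> sub_itv A I -> sub_itv B J ->
    good_transpose f A B.
  by rewrite good_transposeE; exact: good_sub.
have swap_glue I J : good_transpose f (lhalf I) J -> (forall y : R, itv_set J y ->
    exists M, [/\ itv_set M y, sub_itv M J & good_transpose f I M]) ->
    good_transpose f I J.
  by rewrite good_transposeE; exact: good_glue.
have d : cells (good_transpose f) Th Tv by move=> J I lJ lI; exact: c.
have d' : cells (good_transpose f) Th' Tv' by move=> J I lJ lI; exact: c'.
exact: (vreduced_subtree swap_sub swap_glue d h d').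
Qed.

End Good.

Theorem theorem3p2 (R : realType) (f : R * R -> R * R) (hf : in_2V f) :
  exists! T : tree * tree, reduced_grid_diagram f T.1 T.2.
Proof.
have [Tv0 [Th0 /exists_reduced_cells[Tv [Th [c v h]]]]] := exists_good_cells hf.
have red : reduced_grid_diagram f Tv Th.
  split; first by apply: good_grid_diagram c; case: hf.
    exact/vertically_reducedE.
  exact/horizontally_reducedE.
exists (Tv, Th); split=> // -[Tv' Th'] /= red'.
have [vs hs] := reduced_subtrees red red'.
have [vs' hs'] := reduced_subtrees red' red.
by congr (_, _); exact: subtree_anti.
Qed.
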